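(* Let $B_1,\dots,B_p$ be real $d\times d$ matrices with $B_i^T+B_i\le 0$ for $i=1,\dots,p$, and let $u$ be an input. Assume that $\bigcap_{i\in J_u}\mathcal{K}_i=\{0\}$. Then the matrix $S_u$ is equal to $0$, and the switched system $\dot x=B_{u(t)}x$ is asymptotically stable for $u$, as soon as for $r>0$ no connected component of $$\Big(\bigcup_{i\in J_u}\mathcal{K}_i\Big)\cap S_r$$ intersects all the $\mathcal{K}_i$'s for $i\in J_u$. This condition on connected components is verified (under the assumption $\bigcap_{i\in J_u}\mathcal{K}_i=\{0\}$) in the following cases: 1. the cardinal of $J_u$ is $2$; 2. the cardinal $q$ of $J_u$ is larger than $2$, but $\dim\big(\sum_{i\in J_u}\mathcal{K}_i\big)>\sum_{i\in J_u}\dim(\mathcal{K}_i)-q+1$; 3. there exists $i\in J_u$ such that $\dim\mathcal{K}_i=0$; 4. there exists $i\in J_u$ such that $\dim\mathcal{K}_i=1$, but $\mathcal{K}_i\nsubseteq\mathcal{K}_j$ for all $j\in J_u$, $j\neq i$. In particular for $d=2$, at least one of these four conditions is satisfied as soon as $\mathcal{K}_i\ne\mathbb{R}^2$ for all $i\in J_u$.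
   Context: For a symmetric matrix $Q$, $Q\le 0$ means $x^TQx\le 0$ for all $x\in\mathbb{R}^d$; $\|\cdot\|$ is the Euclidean norm and $S_r=\{x\in\mathbb{R}^d;\ \|x\|=r\}$. An input (switching signal) is a piecewise constant, right-continuous function $u:[0,+\infty[\to\{1,\dots,p\}$, with switching times $(a_n)_{n\ge0}$, $a_0=0$, strictly increasing to $+\infty$; $u$ is constant, equal to $u_n$, on $[a_n,a_{n+1}[$, and $\delta_n=a_{n+1}-a_n$. The solution of $\dot x=B_{u(t)}x$ from $x$ is $t\mapsto\Phi_u(t)x$, where $\Phi_u(t)=\exp((t-a_n)B_{u_n})\exp(\delta_{n-1}B_{u_{n-1}})\cdots\exp(\delta_0B_{u_0})$ for $t\in[a_n,a_{n+1}[$. The matrix $\Phi_u(t)^T\Phi_u(t)$ converges as $t\to+\infty$, and $S_u$ denotes the symmetric nonnegative square root of its limit. The system is asymptotically stable for $u$ if $\Phi_u(t)x\to0$ as $t\to+\infty$ for every $x\in\mathbb{R}^d$. For each $i$, $\mathcal{K}_i=\ker(B_i^T+B_i)$. With $m$ the Lebesgue measure on the real line, $J_u=\{i\in\{1,\dots,p\};\ m\{t\ge0;\ u(t)=i\}=+\infty\}$. *)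

(* Defs.v *)
From HB Require Import structures.
From mathcomp Require Import all_boot all_order all_algebra.
From mathcomp Require Import all_classical all_reals all_analysis.

Set Implicit Arguments.
Unset Strict Implicit.
Unset Printing Implicit Defensive.

Import Order.TTheory GRing.Theory Num.Theory.
Import numFieldNormedType.Exports.

Local Open Scope classical_set_scope.
Local Open Scope ring_scope.

(* The modes 1, ..., p are the elements of 'I_p, and R^d is 'cV[R]_d.         *)
(* Matrices carry the library's (entrywise) topology, which is the Euclidean  *)
(* one; only the sphere depends on the choice of the Euclidean norm.          *)

Definition mx_le0 (R : realType) (d : nat) (Q : 'M[R]_d) : Prop :=
  forall x : 'cV[R]_d, (x^T *m Q *m x) 0 0 <= 0.

Definition mx_ge0 (R : realType) (d : nat) (Q : 'M[R]_d) : Prop :=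
  forall x : 'cV[R]_d, 0 <= (x^T *m Q *m x) 0 0.

Definition enorm (R : realType) (d : nat) (x : 'cV[R]_d) : R :=
  Num.sqrt (\sum_(i < d) x i 0 ^+ 2).

Definition esphere (R : realType) (d : nat) (r : R) : set 'cV[R]_d :=
  [set x | enorm x = r].

Definition expmx (R : realType) (d : nat) (A : 'M[R]_d) : 'M[R]_d :=
  limn (series (fun k => (k`!%:R : R)^-1 *: (A ^+ k : 'M[R]_d))).

(* An input together with its switching times.  Consecutive values of the     *)
(* signal may coincide, so that inputs which are eventually constant are      *)
(* covered.  The values of the signal at negative times play no role.         *)
Record input (R : realType) (p : nat) := Input {
  signal :> R -> 'I_p;
  stime : nat -> R;
  stime0 : stime 0%N = 0;
  stime_incr : forall n, stime n < stime n.+1;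
  stime_cvg : stime @ \oo --> +oo;
  signal_const : forall n t, stime n <= t < stime n.+1 ->
    signal t = signal (stime n)
}.

(* Phi_u at the n-th switching time *)
Fixpoint flow_at (R : realType) (d p : nat) (B : 'I_p -> 'M[R]_d)
    (u : input R p) (n : nat) : 'M[R]_d :=
  if n is m.+1 then
    expmx ((stime u m.+1 - stime u m) *: B (u (stime u m))) *m flow_at B u m
  else 1%:M.

(* The default value is reached only for t < 0. *)
Definition switch_index (R : realType) (p : nat) (u : input R p) (t : R) : nat :=
  xget 0%N [set n | stime u n <= t < stime u n.+1].

Definition flow (R : realType) (d p : nat) (B : 'I_p -> 'M[R]_d)
    (u : input R p) (t : R) : 'M[R]_d :=
  let n := switch_index u t in
  expmx ((t - stime u n) *: B (u (stime u n))) *m flow_at B u n.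

Definition is_limit_sqrt (R : realType) (d p : nat) (B : 'I_p -> 'M[R]_d)
    (u : input R p) (S : 'M[R]_d) : Prop :=
  [/\ S^T = S, mx_ge0 S &
      (flow B u t)^T *m flow B u t @[t --> +oo] --> S *m S].

(* S_u.  Since 0 is also the default value here, S_u = 0 is informative only  *)
(* together with is_limit_sqrt B u (limit_sqrt B u).                          *)
Definition limit_sqrt (R : realType) (d p : nat) (B : 'I_p -> 'M[R]_d)
    (u : input R p) : 'M[R]_d :=
  xget 0 [set S | is_limit_sqrt B u S].

Definition asymptotically_stable (R : realType) (d p : nat)
    (B : 'I_p -> 'M[R]_d) (u : input R p) : Prop :=
  forall x : 'cV[R]_d, flow B u t *m x @[t --> +oo] --> (0 : 'cV[R]_d).

Definition Ker (R : realType) (d p : nat) (B : 'I_p -> 'M[R]_d) (i : 'I_p) :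
    {vspace 'cV[R]_d} :=
  lker (linfun (mulmx ((B i)^T + B i) : 'cV[R]_d -> 'cV[R]_d)).

Definition J_ (R : realType) (p : nat) (u : input R p) : {set 'I_p} :=
  finset (fun i : 'I_p =>
    `[< lebesgue_measure [set t : R | 0 <= t /\ u t = i] = +oo%E >]).

Definition components (T : topologicalType) (A : set T) : set (set T) :=
  [set connected_component A x | x in A].

Definition no_component_meets_all (R : realType) (d p : nat)
    (K : 'I_p -> {vspace 'cV[R]_d}) (J : {set 'I_p}) (r : R) : Prop :=
  let X := [set x : 'cV[R]_d | exists2 i, i \in J & x \in K i]
           `&` esphere r in
  ~ exists2 C, components X C &
      forall i, i \in J -> C `&` [set x | x \in K i] !=set0.

Definition card2_case (p : nat) (J : {set 'I_p}) : Prop := #|J| = 2%N.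

Definition dim_sum_case (R : realType) (d p : nat)
    (K : 'I_p -> {vspace 'cV[R]_d}) (J : {set 'I_p}) : Prop :=
  (2 < #|J|)%N /\
  ((\dim (\sum_(i in J) K i)%VS)%:Z >
     (\sum_(i in J) \dim (K i))%N%:Z - #|J|%:Z + 1).

Definition trivial_kernel_case (R : realType) (d p : nat)
    (K : 'I_p -> {vspace 'cV[R]_d}) (J : {set 'I_p}) : Prop :=
  exists2 i, i \in J & \dim (K i) = 0%N.

Definition isolated_line_case (R : realType) (d p : nat)
    (K : 'I_p -> {vspace 'cV[R]_d}) (J : {set 'I_p}) : Prop :=
  exists i, [/\ i \in J, \dim (K i) = 1%N &
    forall j, j \in J -> j != i -> ~~ (K i <= K j)%VS].

(* Main.v *)
Require Import Defs.
From HB Require Import structures.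
From mathcomp Require Import all_boot all_order all_algebra.
From mathcomp Require Import all_classical all_reals all_analysis.
From mathcomp Require Import ring lra zify.
Import Order.TTheory GRing.Theory Num.Theory.
Import numFieldNormedType.Exports.
Local Open Scope classical_set_scope.
Local Open Scope ring_scope.
Set Implicit Arguments.
Unset Strict Implicit.
Unset Printing Implicit Defensive.

(** Along a trajectory x(t) the energy |x|^2 is nonincreasing, since its
    derivative on a piece in mode i is the nonpositive form given by B_i^T + B_i.
    Hence the energy converges, and stability means that its limit is 0 for
    every initial condition.  If the limit is positive, scaling the initial
    condition makes it r^2.  Let Omega be the set of cluster points of x(t) at
    infinity.  Its properties contradict the hypothesis on components:

    - Omega lies on the sphere of radius r, is nonempty and compact because x is
      bounded, and is connected because x is continuous;
    - Omega meets K_i for every i in J_u.  Otherwise the dissipation in mode i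
      would exceed a positive constant near Omega, and since mode i is active for
      an infinite time, the energy would become negative
      ([limit_set_meets_Ker]);
    - Omega is contained in the union of the K_i for i in J_u.  Near a point
      outside that union every mode of J_u dissipates at a rate c > 0.  The
      curve is Lipschitz, so each of its infinitely many visits to that
      neighbourhood lasts a fixed time tau; the modes outside J_u fill only a
      finite total time, so late visits each cost an energy close to c tau,
      against the convergence of the energy ([limit_set_sub_Ker]).

    So Omega lies in one connected component of the union of the K_i cut with
    the sphere, and this component meets every K_i: the very situation that is
    excluded by hypothesis.  The matrix Phi^T Phi then tends to 0, and the only
    symmetric square root of 0 is 0.

    For the four criteria, the traces of the subspaces on the sphere are closed.
    If J_u splits into two nonempty parts such that a subspace of the first
    meets a subspace of the second only at 0, then the traces of the two parts
    are disjoint closed sets and no connected set meets both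
    ([separated_no_component]).  This settles the case of two modes and that
    of an isolated line.  If instead a component meets all the subspaces, no
    such splitting exists, so the modes can be added one at a time, each new
    subspace meeting nontrivially the sum of the previous ones; every step but
    the first loses at least one dimension, which bounds the dimension of the
    sum ([meeting_component_dim]). *)

(** * Entrywise limits of matrices *)

Lemma cvg_mx (R : realType) (m n : nat) (T : Type) (F : set_system T)
    {FF : Filter F} (f : T -> 'M[R]_(m, n)) (M : 'M[R]_(m, n)) :
  (forall i j, f t i j @[t --> F] --> M i j) -> f t @[t --> F] --> M.
Proof.
move=> fM; apply/cvg_ballP => e e0.
have : \forall t \near F, forall i j, ball (M i j) e (f t i j).
  apply: filter_forall => i; apply: filter_forall => j.
  by move: e e0; apply/cvg_ballP; exact: fM.
by apply: filterS => t fMt; split.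
Qed.

Lemma cvg_entry (R : realType) (m n : nat) (T : Type) (F : set_system T)
    {FF : Filter F} (f : T -> 'M[R]_(m, n)) (M : 'M[R]_(m, n)) i j :
  f t @[t --> F] --> M -> f t i j @[t --> F] --> M i j.
Proof. by move=> fM; exact: (cvg_comp _ _ fM (@coord_continuous _ _ _ i j M)). Qed.

Lemma cvg_sumr (R : realType) (I : Type) (r : seq I) (P : pred I)
    (T : Type) (F : set_system T) {FF : Filter F} (f : I -> T -> R) (l : I -> R) :
  (forall i, P i -> f i t @[t --> F] --> l i) ->
  \sum_(i <- r | P i) f i t @[t --> F] --> \sum_(i <- r | P i) l i.
Proof. by apply: cvg_big; exact: add_continuous. Qed.

Lemma cvg_mulmx (R : realType) (m n q : nat) (T : Type) (F : set_system T)
    {FF : Filter F} (f : T -> 'M[R]_(m, n)) (g : T -> 'M[R]_(n, q))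
    (M : 'M[R]_(m, n)) (N : 'M[R]_(n, q)) :
  f t @[t --> F] --> M -> g t @[t --> F] --> N ->
  f t *m g t @[t --> F] --> M *m N.
Proof.
move=> fM gN; apply: cvg_mx => i j; rewrite mxE.
under eq_fun do rewrite mxE.
by apply: cvg_sumr => k _; apply: cvgM; apply: cvg_entry.
Qed.

Lemma cvg_trmx (R : realType) (m n : nat) (T : Type) (F : set_system T)
    {FF : Filter F} (f : T -> 'M[R]_(m, n)) (M : 'M[R]_(m, n)) :
  f t @[t --> F] --> M -> (f t)^T @[t --> F] --> M^T.
Proof.
move=> fM; apply: cvg_mx => i j; rewrite mxE.
by under eq_fun do rewrite mxE; apply: cvg_entry.
Qed.

(** Transposition carries the compactness of boxes of row vectors over to
    column vectors. *)
Lemma compact_cV_box (R : realType) (d : nat) (M : R) :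
  compact [set x : 'cV[R]_d | forall i, `|x i 0| <= M].
Proof.
have -> : [set x : 'cV[R]_d | forall i, `|x i 0| <= M] =
    trmx @` [set v : 'rV[R]_d | forall i, v ord0 i \in `[(- M), M]].
  apply/seteqP; split=> [x xM|_ [v vM <-] i].
    exists x^T; last by rewrite trmxK.
    by move=> i /=; rewrite mxE in_itv /= -ler_norml; exact: xM.
  by rewrite mxE; have := vM i; rewrite in_itv /= -ler_norml.
apply: continuous_compact.
  apply: continuous_subspaceT => v; apply: (@cvg_trmx _ _ _ _ (nbhs v)).
  exact: cvg_id.
apply: (@rV_compact _ _ (fun=> `[(- M), M]%classic)) => _.
exact: segment_compact.
Qed.

(** A subspace is the fixed locus of a projection onto it, hence the kernel of
    a matrix, and linear maps given by matrices are continuous. *)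
Lemma closed_vspace (R : realType) (d : nat) (V : {vspace 'cV[R]_d}) :
  closed [set x : 'cV[R]_d | x \in V].
Proof.
pose M : 'M[R]_d := \matrix_(i, j) (projv V (delta_mx j 0)) i 0.
have projE x : projv V x = M *m x.
  rewrite {1}(matrix_sum_delta x) linear_sum /=; apply/colP => i.
  rewrite summxE [RHS]mxE; apply: eq_bigr => j _.
  by rewrite big_ord1 linearZ /= !mxE mulrC.
have -> : [set x : 'cV[R]_d | x \in V] = (fun x => (M - 1%:M) *m x) @^-1` [set 0].
  apply/seteqP; split=> x /=; rewrite mulmxBl mul1mx -projE.
    by move=> xV; rewrite projv_id ?subrr.
  by move/eqP; rewrite subr_eq0 => /eqP <-; exact: memv_proj.
apply: closed_comp => [x _|].
  by apply: (@cvg_mulmx _ _ _ _ _ (nbhs x)); [exact: cvg_cst|exact: cvg_id].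
exact/accessible_closed_set1/hausdorff_accessible/norm_hausdorff.
Qed.

(** * The exponential of a matrix *)

Section expmx.
Variables (R : realType) (d : nat).
Implicit Types (A : 'M[R]_d) (t : R).

Definition mx_sum_norm A : R := \sum_(i < d) \sum_(j < d) `|A i j|.

(** The sum of the absolute values of the entries is a submultiplicative norm
    that dominates every entry; this majorizes the exponential series of a matrix
    by a scalar one. *)
Lemma norm_expr_mx_le A k i j : `|(A ^+ k) i j| <= mx_sum_norm A ^+ k.
Proof.
elim: k i j => [|k IH] i j.
  by rewrite expr0 expr0 mxE; case: (i == j); rewrite ?normr1 ?normr0.
rewrite exprS -mulmxE mxE exprS; apply: le_trans (ler_norm_sum _ _ _) _.
under eq_bigr do rewrite normrM.
apply: (@le_trans _ _ ((\sum_(l < d) `|A i l|) * mx_sum_norm A ^+ k)).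
  by rewrite mulr_suml; apply: ler_sum => l _; apply: ler_wpM2l.
apply: ler_wpM2r; first by rewrite exprn_ge0// sumr_ge0// => *; rewrite sumr_ge0.
rewrite /mx_sum_norm [leRHS](bigD1 i)//= lerDl; apply: sumr_ge0 => l _.
exact: sumr_ge0.
Qed.

Definition expmx_coef A i j (k : nat) : R := (A ^+ k) i j / k`!%:R.

(** The formal derivative of an entry of the exponential series shifts the power
    of the matrix by one; iterating it never leaves the family of series handled by
    [cvg_pseries_expmx]. *)
Lemma expmx_coef_shift A i j :
  pseries_diffs (expmx_coef A i j) =
  fun k => (A ^+ k.+1) i j / k`!%:R.
Proof.
apply/funext => k; rewrite /pseries_diffs /expmx_coef factS natrM invfM.
by rewrite mulrCA mulVKf ?pnatr_eq0.
Qed.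

(** The factor C makes this single statement cover the entries of the series of
    the exponential and of its first two formal derivatives, with C equal to
    1, A and A^2. *)
Lemma cvg_pseries_expmx A (C : 'M[R]_d) i j x :
  cvgn (pseries (fun k => (C *m A ^+ k) i j / k`!%:R) x).
Proof.
pose c := \sum_(l < d) `|C i l|.
have c0 : 0 <= c by apply: sumr_ge0.
have s0 : 0 <= mx_sum_norm A by do 2 apply: sumr_ge0 => ? _.
apply: normed_cvg.
apply: (series_le_cvg (v_ := fun k => c * exp_coeff (mx_sum_norm A * `|x|) k)).
- by move=> k; exact: normr_ge0.
- move=> k; rewrite /exp_coeff /=.
  by apply: mulr_ge0 => //; rewrite divr_ge0 ?exprn_ge0 ?mulr_ge0.
- move=> k /=; rewrite /exp_coeff /= !normrM normrX normfV normr_nat.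
  rewrite exprMn 2!(mulrA c) [leLHS]mulrAC.
  apply: ler_wpM2r; first by rewrite invr_ge0.

  apply: ler_wpM2r; first by rewrite exprn_ge0.
  rewrite mxE; apply: le_trans (ler_norm_sum _ _ _) _.
  rewrite mulr_suml; apply: ler_sum => l _; rewrite normrM.
  by apply: ler_wpM2l => //; exact: norm_expr_mx_le.
- apply: is_cvg_seriesZ; exact: is_cvg_series_exp_coeff.
Qed.

Lemma exprZ_mx t A k : (t *: A) ^+ k = t ^+ k *: A ^+ k.
Proof.
elim: k => [|k IH]; first by rewrite !expr0 scale1r.
by rewrite !exprS IH -!mulmxE -scalemxAl -scalemxAr scalerA.
Qed.

Lemma expmx_entryE A t i j :
  expmx (t *: A) i j = limn (pseries (expmx_coef A i j) t).
Proof.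
pose L := (\matrix_(i, j) limn (pseries (expmx_coef A i j) t)) : 'M[R]_d.
suff -> : expmx (t *: A) = L by rewrite mxE.
apply/cvg_lim; first exact: norm_hausdorff.
apply: cvg_mx => k l; rewrite mxE.
have -> : (fun n => series (fun k => (k`!%:R : R)^-1 *: (t *: A) ^+ k) n k l)
    = pseries (expmx_coef A k l) t.
  apply/funext => n; rewrite /series /pseries /= summxE; apply: eq_bigr => m _.
  by rewrite exprZ_mx !mxE /expmx_coef mulrCA [RHS]mulrC [X in _ = _ * X]mulrC.
have := @cvg_pseries_expmx A 1%:M k l t.
by under eq_fun do rewrite mul1mx.
Qed.

(** Each entry is a power series in t, which may be differentiated term by term
    because it converges everywhere together with its first two formal
    derivatives. *)
Lemma is_derive_expmx A t i j :
  is_derive t 1 (fun t => expmx (t *: A) i j) ((A *m expmx (t *: A)) i j).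
Proof.
have cv (C : 'M[R]_d) x k l := @cvg_pseries_expmx A C k l x.
have c0 : expmx_coef A i j = fun k => (1%:M *m A ^+ k) i j / k`!%:R.
  by apply/funext => k; rewrite mul1mx.
have c1 : pseries_diffs (expmx_coef A i j) =
    fun k => (A *m A ^+ k) i j / k`!%:R.
  by rewrite expmx_coef_shift; apply/funext => k; rewrite exprS mulmxE.
have c2 : pseries_diffs (pseries_diffs (expmx_coef A i j)) =
    fun k => ((A *m A) *m A ^+ k) i j / k`!%:R.
  apply/funext => k; rewrite {1}/pseries_diffs expmx_coef_shift factS natrM.
  by rewrite invfM mulrCA mulVKf ?pnatr_eq0// !exprS -!mulmxE mulmxA.
have -> : (fun t => expmx (t *: A) i j) =
    (fun t => limn (pseries (expmx_coef A i j) t)).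
  by apply/funext => s; exact: expmx_entryE.
have -> : (A *m expmx (t *: A)) i j =
    limn (pseries (pseries_diffs (expmx_coef A i j)) t).
  apply/esym/cvg_lim => //; rewrite mxE c1.
  under eq_bigr do rewrite expmx_entryE.
  have -> : pseries (fun k => (A *m A ^+ k) i j / k`!%:R) t =
      (fun n => \sum_(l < d) A i l * pseries (expmx_coef A l j) t n).
    apply/funext => n; rewrite /pseries /series /=.
    under [RHS]eq_bigr do rewrite mulr_sumr.
    rewrite exchange_big /=; apply: eq_bigr => m _.
    rewrite mxE !mulr_suml; apply: eq_bigr => l _.
    by rewrite /expmx_coef !mulrA.
  apply: cvg_sumr => l _; apply: cvgMr.
  by have := cv 1%:M t l j; under eq_fun do rewrite mul1mx.
apply: (@pseries_snd_diffs _ _ (`|t| + 1)).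
- by rewrite c0; exact: cv.
- by rewrite c1; exact: cv.
- by rewrite c2; exact: cv.
by rewrite [ltRHS]ger0_norm ?addr_ge0// ltrDl.
Qed.

Lemma expmx0 : expmx (0 : 'M[R]_d) = 1%:M.
Proof.
apply/cvg_lim; first exact: norm_hausdorff.
apply: cvg_near_cst; near=> n; rewrite -[n]prednK; last by near: n.
rewrite /series /= big_nat_recl// expr0 fact0 invr1 scale1r.
by rewrite big1 ?addr0// => k _; rewrite exprS mul0r scaler0.
Unshelve. all: by end_near. Qed.

End expmx.

(** * Quadratic forms and the Euclidean norm *)

Section quadratic.
Variables (R : realType) (d : nat).
Implicit Types (Q : 'M[R]_d) (x y : 'cV[R]_d).

Definition quad Q x : R := (x^T *m Q *m x) 0 0.
Definition sqn x : R := \sum_(i < d) x i 0 ^+ 2.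

Lemma quadE Q x : quad Q x = \sum_(i < d) x i 0 * (Q *m x) i 0.
Proof. by rewrite /quad -mulmxA mxE; apply: eq_bigr => i _; rewrite mxE. Qed.

Lemma quad_sym_part Q x :
  quad (Q^T + Q) x = \sum_(i < d) 2 * (x i 0 * (Q *m x) i 0).
Proof.
rewrite -mulr_sumr -quadE /quad mulmxDr mulmxDl mxE mulr2n mulrDl !mul1r.
congr (_ + _).
have -> : x^T *m Q^T *m x = (x^T *m Q *m x)^T by rewrite !trmx_mul trmxK mulmxA.
by rewrite mxE.
Qed.

Lemma sqn_ge0 x : 0 <= sqn x.
Proof. by apply: sumr_ge0 => i _; exact: sqr_ge0. Qed.

Lemma sqnZ a x : sqn (a *: x) = a ^+ 2 * sqn x.
Proof. by rewrite mulr_sumr; apply: eq_bigr => i _; rewrite mxE exprMn. Qed.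

Lemma sqr_entry_le_sqn x i : x i 0 ^+ 2 <= sqn x.
Proof. by rewrite /sqn (bigD1 i)//= lerDl sumr_ge0// => j _; exact: sqr_ge0. Qed.

Lemma continuous_sqn : continuous sqn.
Proof.
move=> x; apply: (@cvg_sumr _ _ _ _ _ (nbhs x)) => i _.
by under eq_fun do rewrite expr2; apply: cvgM; exact: coord_continuous.
Qed.

Lemma continuous_quad Q : continuous (quad Q).
Proof.
move=> x; apply: (@cvg_entry _ _ _ _ (nbhs x)).
apply: (@cvg_mulmx _ _ _ _ _ (nbhs x)); last exact: cvg_id.
by apply: (@cvg_mulmx _ _ _ _ _ (nbhs x)); [apply: cvg_trmx; exact: cvg_id|exact: cvg_cst].
Qed.

(** Isotropic vectors of a semidefinite form lie in its kernel: expanding the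
    form at x + t z with z = Q x leaves 2 t |z|^2 + t^2 (z^T Q z), which would be
    positive for small t > 0 if z were nonzero. *)
Lemma quad_eq0 Q x : Q^T = Q -> mx_le0 Q -> quad Q x = 0 -> Q *m x = 0.
Proof.
move=> Qsym Qle0 Qx0.
have bilin y t : quad Q (x + t *: y) = 2 * t * (y^T *m (Q *m x)) 0 0 + t ^+ 2 * quad Q y.
  have xy : (x^T *m Q *m y) 0 0 = (y^T *m (Q *m x)) 0 0.
    have -> : x^T *m Q *m y = (y^T *m (Q *m x))^T.
      by rewrite !trmx_mul trmxK Qsym.
    by rewrite mxE.
  have -> : quad Q (x + t *: y) = quad Q x + t * (x^T *m Q *m y) 0 0 +
      t * (y^T *m (Q *m x)) 0 0 + t ^+ 2 * quad Q y.
    rewrite /quad [(x + _)^T]linearD /= linearZ /= mulmxDr !mulmxDl.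
    rewrite -!scalemxAr -!scalemxAl mulmxA.
    move: (x^T *m Q *m x) (y^T *m Q *m x) (x^T *m Q *m y) (y^T *m Q *m y).
    by move=> a b c e; rewrite !mxE; ring.
  by rewrite Qx0 xy; ring.
set z := Q *m x; have Nz : (z^T *m z) 0 0 = sqn z.
  by rewrite mxE; apply: eq_bigr => i _; rewrite mxE expr2.
suff /eqP : sqn z = 0.
  rewrite psumr_eq0 => [/allP z0|i _]; last exact: sqr_ge0.
  apply/colP => i; rewrite [RHS]mxE; apply/eqP.
  by have := z0 i; rewrite mem_index_enum sqrf_eq0 => /(_ isT).
apply/eqP; rewrite eq_le sqn_ge0 andbT leNgt; apply/negP => z_gt0.
have q_le0 : quad Q z <= 0 by exact: Qle0.
(* For this t the expansion equals t (|z|^2 + t). *)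
pose t := sqn z / (1 - quad Q z).
have q_lt1 : 0 < 1 - quad Q z by rewrite subr_gt0 (le_lt_trans q_le0).
have t_gt0 : 0 < t by rewrite divr_gt0.
have := Qle0 (x + t *: z); rewrite -/(quad _ _) bilin -/z Nz.
have -> : 2 * t * sqn z + t ^+ 2 * quad Q z = t * (sqn z + t).
  by rewrite /t; field; rewrite gt_eqF.
by rewrite pmulr_rle0// leNgt addr_gt0.
Qed.

Lemma sqn_esphere (r : R) (x : 'cV[R]_d) : 0 < r ->
  esphere r x <-> sqn x = r ^+ 2.
Proof.
move=> r0; rewrite /esphere /enorm /= -/(sqn x); split=> [<-|->].
  by rewrite sqr_sqrtr// sqn_ge0.
by rewrite sqrtr_sqr gtr0_norm.
Qed.

Lemma cvg0_of_sqn (T : Type) (F : set_system T) {FF : Filter F}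
    (f : T -> 'cV[R]_d) :
  sqn (f t) @[t --> F] --> (0 : R) -> f t @[t --> F] --> (0 : 'cV[R]_d).
Proof.
move=> f0; apply: cvg_mx => i j; rewrite ord1 mxE.
apply/cvgrPdist_lt => e e0; have e2 : 0 < e ^+ 2 by rewrite exprn_gt0.
move/cvgrPdist_lt : f0 => /(_ _ e2); apply: filterS => t.
rewrite !sub0r !normrN ger0_norm ?sqn_ge0// => /(le_lt_trans (sqr_entry_le_sqn _ i)).
by rewrite -[X in X < _]real_normK ?num_real// ltr_pXn2r// ?nnegrE ?ltW.
Qed.

End quadratic.

Lemma mem_Ker (R : realType) (d p : nat) (B : 'I_p -> 'M[R]_d) i x :
  (x \in Ker B i) = (((B i)^T + B i) *m x == 0).
Proof. by rewrite memv_ker lfunE. Qed.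

Lemma mem_Ker_quad (R : realType) (d p : nat) (B : 'I_p -> 'M[R]_d) i x :
  mx_le0 ((B i)^T + B i) ->
  (x \in Ker B i) = (quad ((B i)^T + B i) x == 0).
Proof.
move=> Bi; rewrite mem_Ker; apply/eqP/eqP => [e|].
  by rewrite /quad -mulmxA e mulmx0 mxE.
by apply: quad_eq0 => //; rewrite linearD /= trmxK addrC.
Qed.

(** * Switching times and trajectories *)

Section switching_times.
Variables (R : realType) (p : nat) (u : input R p).

Lemma stime_homo : {homo stime u : m n / (m <= n)%N >-> m <= n}.
Proof. by apply: homo_leq => // [y x z /le_trans|n]; [apply|exact/ltW/stime_incr]. Qed.

Lemma stime_ge0 n : 0 <= stime u n.
Proof. by rewrite -(stime0 u) stime_homo. Qed.

Lemma stime_unbounded t : exists n, t < stime u n.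
Proof.
have /cvgryPgt/(_ t)[n _ tu] := @stime_cvg _ _ u.
by exists n; apply: tu => /=.
Qed.

Lemma ex_piece t : 0 <= t -> exists n, stime u n <= t < stime u n.+1.
Proof.
move=> t0; have [m mP minm] := ex_minnP (stime_unbounded t).
case: m mP minm => [|m] mP minm; first by rewrite stime0 ltNge t0 in mP.
by exists m; rewrite mP andbT leNgt; apply/negP => /minm; rewrite ltnn.
Qed.

Lemma switch_indexE n t : stime u n <= t < stime u n.+1 -> switch_index u t = n.
Proof.
move=> tn; apply: xget_unique => // m tm.
wlog mn : m n tm tn / (m <= n)%N.
  by move=> W; have [/W|/ltnW/W] := leqP m n; [apply|move=> <-].
move: mn; rewrite leq_eqVlt => /predU1P[//|/stime_homo].
by case/andP: tm => _ tm; case/andP: tn => tn _; rewrite leNgt (le_lt_trans tn tm).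
Qed.

(** Monotonicity on each closed piece propagates across the switching times
    because consecutive pieces share an endpoint.  The interval [a, b] localizes
    the hypothesis, so that it can be applied during one visit to a
    neighbourhood. *)
Lemma piecewise_nonincreasing (h : R -> R) a b : 0 <= a ->
  (forall n s t, stime u n <= s -> s <= t -> t <= stime u n.+1 ->
     a <= s -> t <= b -> h t <= h s) ->
  forall t, a <= t <= b -> h t <= h a.
Proof.
move=> a0 hpw t; have [k /ltW] := stime_unbounded t.
elim: k t => [|k IH] t tk /andP[at_ tb].
  by rewrite (@le_anti _ _ a t)// at_ (le_trans tk)// stime0.
have [tk'|kt] := leP t (stime u k); first by apply: IH => //; rewrite at_.
have [ka|ak] := leP (stime u k) a; first exact: (hpw k).
apply: (@le_trans _ _ (h (stime u k))).
  by apply: (hpw k) => //; exact: ltW.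
by apply: IH => //; rewrite (ltW ak) (le_trans (ltW kt) tb).
Qed.

End switching_times.

Section trajectories.
Variables (R : realType) (d p : nat) (B : 'I_p -> 'M[R]_d) (u : input R p).

(** The formula holds up to and including the right end of a piece: the flow is
    continuous there because the exponential of 0 is the identity. *)
Lemma flow_piece n t : stime u n <= t <= stime u n.+1 ->
  flow B u t = expmx ((t - stime u n) *: B (u (stime u n))) *m flow_at B u n.
Proof.
case/andP => nt; rewrite le_eqVlt => /predU1P[->|tn].
  rewrite /flow (@switch_indexE _ _ _ n.+1) ?lexx ?stime_incr//.
  by rewrite subrr scale0r expmx0 mul1mx.
by rewrite /flow (@switch_indexE _ _ _ n) ?nt.
Qed.

Lemma flow0 : flow B u 0 = 1%:M.
Proof.
rewrite (@flow_piece 0%N) ?stime0 ?lexx ?stime_ge0//.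
by rewrite subrr scale0r expmx0 mul1mx.
Qed.

Variable x0 : 'cV[R]_d.

Definition piece_sol n t : 'cV[R]_d :=
  expmx ((t - stime u n) *: B (u (stime u n))) *m (flow_at B u n *m x0).

Lemma traj_piece n t : stime u n <= t <= stime u n.+1 ->
  flow B u t *m x0 = piece_sol n t.
Proof. by move=> tn; rewrite (flow_piece tn) /piece_sol mulmxA. Qed.

Lemma is_derive_piece_sol n (t : R) i :
  is_derive t 1 (fun t : R => piece_sol n t i 0)
    ((B (u (stime u n)) *m piece_sol n t) i 0).
Proof.
rewrite /piece_sol; set C := B _; set w := _ *m x0.
have -> : (fun t => (expmx ((t - stime u n) *: C) *m w) i 0) =
   \sum_(j < d) (fun t => expmx ((t - stime u n) *: C) i j * w j 0).
  by apply/funext => s; rewrite mxE fct_sumE.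
rewrite mulmxA mxE; apply: is_derive_sum => j.
have D : is_derive t 1 (fun t => expmx ((t - stime u n) *: C) i j)
    ((C *m expmx ((t - stime u n) *: C)) i j).
  have D1 := @is_derive_expmx _ _ C (t - stime u n) i j.
  have D2 : is_derive t (1 : R) (fun t => t - stime u n) (1 : R).
    by apply: is_derive_eq; rewrite subr0.
  have := @is_derive1_comp _ (fun t => expmx (t *: C) i j)
    (fun t => t - stime u n) t _ _ D1 D2.
  by rewrite mulr1.
apply: is_derive_eq; rewrite scaler0 add0r; exact: mulrC.
Qed.

End trajectories.

(** * Energy along a trajectory *)

Section energy.
Variables (R : realType) (d p : nat) (B : 'I_p -> 'M[R]_d) (u : input R p).
Variable x0 : 'cV[R]_d.
Hypothesis B_le0 : forall i, mx_le0 ((B i)^T + B i).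

Let x t := flow B u t *m x0.

(** Mean value theorem for the energy, whose derivative is the quadratic form of
    B^T + B. *)
Lemma energy_piece n s t c : stime u n <= s -> s <= t -> t <= stime u n.+1 ->
  (forall v, s <= v <= t ->
     quad ((B (u (stime u n)))^T + B (u (stime u n))) (x v) <= - c) ->
  sqn (x t) + c * (t - s) <= sqn (x s).
Proof.
move=> ns st tn dE; set C := B _ in dE.
pose y := piece_sol B u x0 n.
have xy v : s <= v <= t -> x v = y v.
  by case/andP => sv vt; apply: traj_piece; rewrite (le_trans ns)// (le_trans vt).
have Dy v : is_derive v (1 : R) (fun v : R => sqn (y v)) (quad (C^T + C) (y v)).
  have -> : (fun v : R => sqn (y v)) = \sum_(i < d) (fun v : R => y v i 0) ^+ 2.
    by apply/funext => w; rewrite fct_sumE; apply: eq_bigr => i _; rewrite expr2.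
  rewrite quad_sym_part; apply: is_derive_sum => i.
  have D := is_derive_piece_sol B u x0 n v i.
  apply: is_derive_eq; rewrite /GRing.scale /= expr1. by rewrite -mulrA.
have [v vst ->] : exists2 v, v \in `[s, t]%R & sqn (x t) = sqn (x s) +
    quad (C^T + C) (y v) * (t - s).
  have [v vst e] := MVT_segment st (fun v _ => Dy v)
    (derivable_within_continuous (fun v _ => @ex_derive _ _ _ _ _ _ _ (Dy v))).
  exists v => //; rewrite !xy ?lexx ?st//; move/eqP: e; rewrite subr_eq => /eqP ->.
  by rewrite addrC.
have Qv : quad (C^T + C) (y v) <= - c by rewrite -xy ?dE.
by rewrite -addrA gerDl -mulrDl mulr_le0_ge0 ?subr_ge0// -lerBrDr sub0r.
Qed.

Lemma energy_nonincreasing s t : 0 <= s -> s <= t -> sqn (x t) <= sqn (x s).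
Proof.
move=> s0 st.
apply: (@piecewise_nonincreasing _ _ u (fun v => sqn (x v)) s t) => //; last first.
  by rewrite st lexx.
move=> n v w nv vw wn _ _; have := @energy_piece n v w 0 nv vw wn.
by rewrite mul0r addr0; apply => z _; rewrite oppr0; exact: B_le0.
Qed.

Lemma traj0 : x 0 = x0.
Proof. by rewrite /x flow0 mul1mx. Qed.

(** The energy bounds every coordinate; 1 + |x|^2 is used instead of |x| so that
    no square root is needed. *)
Lemma traj_bounded : exists2 K, 0 < K & forall t i, 0 <= t -> `|x t i 0| <= K.
Proof.
exists (1 + sqn x0) => [|t i t0]; first by rewrite ltr_pwDl ?sqn_ge0.
have e := le_trans (sqr_entry_le_sqn (x t) i) (energy_nonincreasing (lexx 0) t0).
rewrite traj0 in e.
have := sqr_ge0 (`|x t i 0| - 1); rewrite -[in X in X -> _]real_normK ?num_real//.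
rewrite -real_normK ?num_real// in e.
nra.
Qed.

(** The speed |B_k x| is bounded uniformly in the finitely many modes k and in
    the bounded trajectory. *)
Lemma traj_lipschitz : exists2 L, 0 < L & forall s t i, 0 <= s -> s <= t ->
  `|x t i 0 - x s i 0| <= L * (t - s).
Proof.
have [K K0 xK] := traj_bounded.
pose L := 1 + \sum_(k < p) mx_sum_norm (B k) * K.
have B_ge0 (k : 'I_p) : 0 <= mx_sum_norm (B k) by do 2 apply: sumr_ge0 => ? _.
have L0 : 0 < L by rewrite ltr_pwDl// sumr_ge0// => k _; rewrite mulr_ge0// ltW.
have speed k t i : 0 <= t -> `|(B k *m x t) i 0| <= L.
  move=> t0; apply: (@le_trans _ _ (mx_sum_norm (B k) * K)); last first.
    rewrite /L (bigD1 k)//= addrCA lerDl addr_ge0// sumr_ge0// => j _.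
    by rewrite mulr_ge0// ltW.
  rewrite mxE; apply: le_trans (ler_norm_sum _ _ _) _.
  apply: (@le_trans _ _ ((\sum_(l < d) `|B k i l|) * K)).
    rewrite mulr_suml; apply: ler_sum => l _; rewrite normrM.
    by apply: ler_wpM2l => //; exact: xK.
  apply: ler_wpM2r; first exact: ltW.
  by rewrite /mx_sum_norm [leRHS](bigD1 i)//= lerDl sumr_ge0// => j _; rewrite sumr_ge0.
have pc n v w i : stime u n <= v -> v <= w -> w <= stime u n.+1 ->
    `|x w i 0 - x v i 0| <= L * (w - v).
  move=> nv vw wn; pose y := piece_sol B u x0 n.
  have xy z : v <= z <= w -> x z = y z.
    by case/andP => vz zw; apply: traj_piece; rewrite (le_trans nv)// (le_trans zw).
  have Dy z := is_derive_piece_sol B u x0 n z i.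
  have [z zvw e] := MVT_segment vw (fun z _ => Dy z)
    (derivable_within_continuous (fun z _ => @ex_derive _ _ _ _ _ _ _ (Dy z))).
  rewrite !xy ?lexx ?vw// e normrM (ger0_norm (_ : 0 <= w - v)) ?subr_ge0//.
  apply: ler_wpM2r; first by rewrite subr_ge0.
  rewrite in_itv /= in zvw; rewrite -/(y z) -xy//; apply: speed.
  by case/andP: zvw => vz _; apply: le_trans vz; apply: le_trans nv; exact: stime_ge0.
exists L => // s t i s0 st; rewrite ler_norml; apply/andP; split.
  have /= := @piecewise_nonincreasing _ _ u (fun v => - x v i 0 - L * v) s t s0 _ t.
  rewrite st lexx => /(_ _ isT) h; suff : - x t i 0 - L * t <= - x s i 0 - L * s by lra.
  apply: h => n v w nv vw wn _ _.
  by have := pc n v w i nv vw wn; rewrite ler_norml => /andP[]; lra.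
have /= := @piecewise_nonincreasing _ _ u (fun v => x v i 0 - L * v) s t s0 _ t.
rewrite st lexx => /(_ _ isT) h; suff : x t i 0 - L * t <= x s i 0 - L * s by lra.
apply: h => n v w nv vw wn _ _.
by have := pc n v w i nv vw wn; rewrite ler_norml => /andP[]; lra.
Qed.

End energy.

(** * Time spent in a set of modes *)

Section occupation_time.
Variables (R : realType) (p : nat) (u : input R p).
Implicit Types (A : {set 'I_p}) (s t : R).
Let mu := @lebesgue_measure R.

Definition mode_set A : set R := [set t : R | 0 <= t /\ u t \in A].

Definition occupation A t : R := fine (mu (mode_set A `&` `[0, t[)).

Lemma measurable_mode_set A : measurable (mode_set A).
Proof.
have -> : mode_set A = \bigcup_(n in [set n | u (stime u n) \in A])
    `[stime u n, stime u n.+1[%classic.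
  apply/seteqP; split=> [t [t0 tA]|t [n /= nA]].
    have [n tn] := ex_piece u t0; exists n => /=; last by rewrite in_itv.
    by rewrite -(signal_const tn).
  rewrite in_itv /= => tn; split; last by rewrite (signal_const tn).
  by case/andP: tn => nt _; exact: le_trans (stime_ge0 u n) nt.
by apply: bigcup_measurable => n _; exact: measurable_itv.
Qed.

Lemma occupation_fin A s t : mu (mode_set A `&` `[s, t[) \is a fin_num.
Proof.
have mA := measurable_mode_set A.
rewrite ge0_fin_numE//.
apply: (@le_lt_trans _ _ (mu `[s, t[%classic)).
  by apply: le_measure; rewrite ?inE//; exact: measurableI.
by rewrite /mu lebesgue_measure_itv /=; case: ifP => _; rewrite ltry.
Qed.

Lemma occupation_split A s t : 0 <= s -> s <= t ->
  occupation A t = occupation A s + fine (mu (mode_set A `&` `[s, t[)).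
Proof.
move=> s0 st; have mA := measurable_mode_set A.
have -> : occupation A t =
    fine (mu ((mode_set A `&` `[0, s[) `|` (mode_set A `&` `[s, t[))).
  rewrite /occupation; congr (fine (mu _)); rewrite -setIUr; congr (_ `&` _).
  apply/seteqP; split=> v /=; rewrite !in_itv /=.
    move=> /andP[v0 vt]; have [sv|vs] := leP s v; [right|left].
      by rewrite vt.
    by rewrite v0.
  case=> /andP[]; first by move=> -> /lt_le_trans; exact.
  by move=> sv ->; rewrite (le_trans s0).
rewrite /mu measureU ?fineD ?occupation_fin//.
- by apply: measurableI => //; exact: measurable_itv.
- by apply: measurableI => //; exact: measurable_itv.
- apply/seteqP; split=> v //= [[_ +] [_]]; rewrite !in_itv /=.
  by move=> /andP[_ vs] /andP[/(lt_le_trans vs)]; rewrite ltxx.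
Qed.

Lemma occupation_piece A n s t :
  stime u n <= s -> s <= t -> t <= stime u n.+1 ->
  occupation A t - occupation A s = if u (stime u n) \in A then t - s else 0.
Proof.
move=> ns st tn; have s0 : 0 <= s := le_trans (stime_ge0 u n) ns.
rewrite (occupation_split A s0 st) addrC addKr.
have uE v : v \in `[s, t[%R -> u v = u (stime u n).
  rewrite in_itv /= => /andP[sv vt]; apply: signal_const.
  by rewrite (le_trans ns)//= (lt_le_trans vt).
case: ifPn => uA.
  have -> : mode_set A `&` `[s, t[ = `[s, t[%classic.
    apply/setIidPr => v vst; split; last by rewrite uE.
    by move: vst; rewrite /= in_itv /= => /andP[sv _]; exact: le_trans sv.
  rewrite /mu lebesgue_measure_itv /=; move: st; rewrite le_eqVlt.
  by case/predU1P => [->|st]; rewrite ?ltxx ?subrr//= lte_fin st.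
have -> : mode_set A `&` `[s, t[ = set0; last by rewrite /mu measure0.
by apply/seteqP; split=> v //= [[_ vA] /uE vE]; rewrite -vE vA in uA.
Qed.

(** Continuity from below of the measure along the intervals [0, n[. *)
Lemma J_occupation_unbounded i : i \in J_ u ->
  forall M, exists2 t, 0 <= t & M < occupation [set i] t.
Proof.
rewrite inE => /asboolP muoo M; apply: contrapT => noM.
have occM t : 0 <= t -> occupation [set i] t <= M.
  by move=> t0; rewrite leNgt; apply/negP => Mt; apply: noM; exists t.
pose F (n : nat) := mode_set [set i] `&` `[0, n%:R[.
have mF n : measurable (F n).
  by apply: measurableI; [exact: measurable_mode_set|exact: measurable_itv].
have UF : \bigcup_n F n = mode_set [set i].
  apply/seteqP; split=> [t [n _ []]//|t tA]; exists (Num.bound t) => //; split => //.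
  by case: tA => t0 _; rewrite /= in_itv /= t0 archi_boundP.
have cF : (mu \o F) n @[n --> \oo] --> mu (\bigcup_n F n).
  apply: nondecreasing_cvg_mu => //.
    by rewrite UF; exact: measurable_mode_set.
  move=> m n mn; apply/subsetPset => t [tA]; rewrite /= in_itv /= => /andP[t1 tm].
  by split=> //=; rewrite in_itv /= t1 (lt_le_trans tm)// ler_nat.
have : (mu (mode_set [set i]) <= M%:E)%E.
  rewrite -UF -(cvg_lim _ cF)//; apply: lime_le; first by apply/cvg_ex; exists (mu (\bigcup_n F n)).
  near=> n; rewrite /= -[X in (X <= _)%E]fineK ?occupation_fin// lee_fin.
  exact: occM.
have -> : mode_set [set i] = [set t : R | 0 <= t /\ u t = i].
  by apply/seteqP; split=> t [t0 /= ti]; split=> //; move/set1P: ti.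
by rewrite /mu muoo leye_eq.
Unshelve. all: by end_near. Qed.

(** There are finitely many modes, and each mode outside J_u is active for a
    finite time. *)
Lemma occupation_notJ_bounded :
  exists M, forall t, occupation (~: J_ u) t <= M.
Proof.
suff fin : (mu (mode_set (~: J_ u)) < +oo)%E.
  exists (fine (mu (mode_set (~: J_ u)))) => t.
  have mJ := measurable_mode_set (~: J_ u).
  apply: fine_le; rewrite ?occupation_fin ?ge0_fin_numE//.
  by apply: le_measure; rewrite ?inE//; apply: measurableI => //; exact: measurable_itv.
have -> : mode_set (~: J_ u) =
    \big[setU/set0]_(i < p | i \notin J_ u) mode_set [set i].
  rewrite -bigcup_seq_cond; apply/seteqP; split=> [t [t0 tJ]|t [i /= /andP[_ iJ] [t0 ti]]].
    exists (u t) => /=; first by rewrite mem_index_enum; rewrite inE in tJ.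
    by split=> //; exact: set11.
  by split=> //; move/set1P: ti => ->; rewrite inE.
rewrite /mu measure_bigsetU_ord.
- apply: lte_sum_pinfty => i; rewrite inE => iJ; rewrite ltey; apply: contra iJ => /eqP iJ.
  apply/asboolP; rewrite -[LHS]/(mu _) -iJ; congr (mu _).
  by apply/seteqP; split=> t [t0 /= ti]; split=> //; [apply/set1P|move/set1P: ti].
- by move=> i; exact: measurable_mode_set.
- apply/trivIsetP => i j _ _ ij; apply/seteqP; split=> t //= -[[_ /set1P ti] [_ /set1P tj]].
  by rewrite -ti -tj eqxx in ij.
Qed.

End occupation_time.

(** At every time exactly one of the two complementary families is active, so
    the two occupation times grow together at unit rate. *)
Lemma occupationC (R : realType) (p : nat) (u : input R p) (A : {set 'I_p}) t :
  0 <= t -> occupation u (~: A) t = t - occupation u A t.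
Proof.
move=> t0; have occ0 C : occupation u C 0 = 0.
  by rewrite /occupation set_itvco0 setI0 measure0.
have pc n v w : stime u n <= v -> v <= w -> w <= stime u n.+1 ->
    occupation u (~: A) w + occupation u A w - w =
    occupation u (~: A) v + occupation u A v - v.
  move=> nv vw wn; have := occupation_piece A nv vw wn.
  have := occupation_piece (~: A) nv vw wn; rewrite finset.in_setC.
  by case: (_ \in A) => /=; lra.
pose h v := occupation u (~: A) v + occupation u A v - v.
have up : h t <= h 0.
  apply: (@piecewise_nonincreasing _ _ u h 0 t) => [//|n v w nv vw wn _ _|].
    by rewrite /h (pc n v w).
  by rewrite t0 lexx.
have down : - h t <= - h 0.
  apply: (@piecewise_nonincreasing _ _ u (fun v => - h v) 0 t) => [//|n v w nv vw wn _ _|].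
    by rewrite /h (pc n v w).
  by rewrite t0 lexx.
by move: up down; rewrite /h !occ0; lra.
Qed.

Lemma occupation_nondecreasing (R : realType) (p : nat) (u : input R p)
    (A : {set 'I_p}) s t :
  0 <= s -> s <= t -> occupation u A s <= occupation u A t.
Proof.
by move=> s0 st; rewrite (occupation_split _ _ s0 st) lerDl fine_ge0.
Qed.

(** * Limit sets of bounded curves *)

Section limit_set.
Variables (R : realType) (T : pseudoMetricType R).
Implicit Types (x : R -> T) (K A : set T).

Definition limit_set x : set T := cluster (x t @[t --> +oo]).

Lemma closed_limit_set x : closed (limit_set x).
Proof.
by rewrite /limit_set clusterE; apply: closed_bigI => B _; exact: closed_closure.
Qed.

Lemma limit_set_tail x y (t0 : R) (U : set T) :
  limit_set x y -> nbhs y U -> exists2 t, t0 <= t & U (x t).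
Proof.
(* The image of a tail belongs to the filter of the curve at infinity. *)
have x_tail : \forall t \near +oo, (x @` [set t | t0 <= t]) (x t).
  by near=> t; exists t => //=; near: t; exact: nbhs_pinfty_ge.
by move=> xy yU; have [_ [[t t0t <-] Ut]] := xy _ U x_tail yU; exists t.
Unshelve. all: by end_near. Qed.

(** A curve in a compact set that visits a closed set at arbitrarily late times
    accumulates there: extract a cluster point from a sequence of such visits. *)
Lemma limit_set_meets x K A : compact K -> (forall t, 0 <= t -> K (x t)) ->
  closed A -> (forall t0, exists2 t, t0 <= t & A (x t)) ->
  exists2 y, limit_set x y & A y.
Proof.
move=> cK xK cA xA.
have [|tau tauP] := @choice _ _ (fun (n : nat) t => n%:R <= t /\ A (x t)).
  by move=> n; have [t nt At] := xA n%:R; exists t.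
have tauoo : tau n @[n --> \oo] --> +oo.
  apply/cvgryPge => M; near=> n; apply: le_trans (tauP n).1.
  by near: n; exact: nbhs_infty_ger.
pose F := x (tau n) @[n --> \oo].
have FK : F K by exists 0%N => // n _; apply: xK; exact: le_trans (tauP n).1.
have [y [Ky Fy]] := cK F _ FK.
exists y; first by apply: cvg_cluster Fy; exact: cvg_comp tauoo _.
apply: cA => U yU; apply: Fy => //; exists 0%N => // n _; exact: (tauP n).2.
Unshelve. all: by end_near. Qed.

(** If the limit set split into two nonempty closed parts, these would have
    disjoint open neighbourhoods, and a continuous curve visiting both infinitely
    often would leave their union at arbitrarily late times.  By compactness it
    would then accumulate outside both, against the choice of the
    neighbourhoods. *)
Lemma connected_limit_set x K : compact K -> (forall t, 0 <= t -> K (x t)) ->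
  {within `[0, +oo[, continuous x} -> connected (limit_set x).
Proof.
move=> cK xK cx F [y Fy] [G oG FG] [C cC FC]; apply: contrapT => FneqO.
have [z lz nFz] : exists2 z, limit_set x z & ~ F z.
  apply: contrapT => noz; apply: FneqO; apply/seteqP; split=> [z|z xz].
    by rewrite FG => -[].
  by apply: contrapT => nFz; apply: noz; exists z.
have cF : closed F by rewrite FC; apply: closedI => //; exact: closed_limit_set.
have cF' : closed (limit_set x `&` ~` G).
  by apply: closedI; [exact: closed_limit_set|exact: open_closedC].
have FIF : F `&` (limit_set x `&` ~` G) = set0.
  by apply/seteqP; split=> w //=; rewrite FG => -[[_ ?] []].
have [U [V [oU oV FU F'V UV]]] :=
  (@normal_openP R T).1 pseudometric_normal _ _ cF cF' FIF.
have UVx w : U w -> V w -> False.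
  by move=> Uw Vw; suff : (U `&` V) w by rewrite UV.
have Vz : V z by apply: F'V; split => // Gz; apply: nFz; rewrite FG.
have crossing t0 : exists2 t, t0 <= t & (~` (U `|` V)) (x t).
  have Fx : limit_set x y by move: Fy; rewrite FG => -[].
  have [t1 t01 Ut1] := limit_set_tail (Num.max 0 t0) Fx
    (open_nbhs_nbhs (conj oU (FU _ Fy))).
  have [t2 t12 Vt2] := limit_set_tail t1 lz (open_nbhs_nbhs (conj oV Vz)).
  rewrite ge_max in t01; case/andP: t01 => t1_ge0 t01.
  apply: contrapT => nocross.
  have inUV t : `[t1, t2]%classic t -> (U `|` V) (x t).
    move=> tt; apply: contrapT => nUV; apply: nocross; exists t => //.
    by move: tt; rewrite /= in_itv /= => /andP[/(le_trans t01)].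
  have I1 : `[t1, t2]%classic t1 by rewrite /= in_itv /= lexx.
  have I2 : `[t1, t2]%classic t2 by rewrite /= in_itv /= lexx andbT.
  have cI : connected (x @` `[t1, t2]).
    apply: connected_continuous_connected; first exact: segment_connected.
    apply: continuous_subspaceW cx => t /=; rewrite !in_itv /= andbT.
    by case/andP => t1t _; exact: le_trans t1t.
  have /seteqP[_ /(_ (x t2))] : (x @` `[t1, t2]) `&` U = x @` `[t1, t2].
    apply: cI.
    - by exists (x t1); split => //; exists t1.
    - by exists U.
    - exists (~` V); first exact: open_closedC.
      apply/seteqP; split=> w [[t tt <-]] => [Ut|nVt]; split=> //; try by exists t.
      + by move=> /(UVx _ Ut).
      + by have [|//] := inUV _ tt.
  by case=> [|_ Ut2]; [exists t2|exact: UVx Ut2 Vt2].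
have [w xw nUVw] := limit_set_meets cK xK (open_closedC (openU oU oV)) crossing.
apply: nUVw; have [Gw|nGw] := pselect (G w).
  by left; apply: FU; rewrite FG.
by right; apply: F'V.
Qed.

End limit_set.

Lemma limit_set_sub_closed (R : realType) (T : pseudoMetricType R) (x : R -> T)
    (A : set T) (t0 : R) :
  closed A -> (forall t, t0 <= t -> A (x t)) -> limit_set x `<=` A.
Proof.
move=> cA xA y xy; apply: cA => U yU.
by have [t t0t Ut] := limit_set_tail t0 xy yU; exists (x t); split => //; exact: xA.
Qed.

(** * The limit set of a trajectory *)

(** Convergence at infinity of a nonincreasing function that is bounded below,
    in a form that keeps the lower bound at every time. *)
Lemma nonincreasing_inf_limit (R : realType) (h : R -> R) (m : R) :
  (forall s t, 0 <= s -> s <= t -> h t <= h s) ->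
  (forall t, 0 <= t -> m <= h t) ->
  exists l, (forall t, 0 <= t -> l <= h t) /\
    forall e, 0 < e -> exists2 T, 0 <= T & forall t, T <= t -> h t < l + e.
Proof.
move=> hdec hm; pose S := [set h t | t in [set t : R | 0 <= t]].
have S_inf : has_inf S.
  by split; [exists (h 0), 0 => //=|exists m => _ [t t0 <-]; exact: hm].
exists (inf S); split => [t t0|e e0].
  by apply: ge_inf; [exact: S_inf.2|exists t].
have [_ [T T0 <-] hT] := inf_adherent e0 S_inf.
by exists T => // t Tt; apply: le_lt_trans hT; exact: hdec.
Qed.

Section limit_set_of_trajectory.
Variables (R : realType) (d p : nat) (B : 'I_p -> 'M[R]_d) (u : input R p).
Hypothesis B_le0 : forall i, mx_le0 ((B i)^T + B i).
Variable x0 : 'cV[R]_d.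

Let x t := flow B u t *m x0.
Let Q i := (B i)^T + B i.

(** If the modes of A dissipate at rate at least c during [a, b], the energy drops
    by at least c times the time spent in A. *)
Lemma energy_occupation (A : {set 'I_p}) (c a b : R) : 0 <= a ->
  (forall t k, a <= t <= b -> k \in A -> quad (Q k) (x t) <= - c) ->
  forall t, a <= t <= b ->
    sqn (x t) + c * occupation u A t <= sqn (x a) + c * occupation u A a.
Proof.
move=> a0 dE t tab.
apply: (@piecewise_nonincreasing _ _ u
  (fun v => sqn (x v) + c * occupation u A v) a b) => // n v w nv vw wn av wb.
have := occupation_piece A nv vw wn; case: ifPn => [uA|_] occ.
  suff : sqn (x w) + c * (w - v) <= sqn (x v) by move: occ; nra.
  apply: (energy_piece nv vw wn) => z /andP[vz zw]; apply: dE => //.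
  by rewrite (le_trans av)//= (le_trans zw).
have -> : occupation u A w = occupation u A v by lra.
rewrite lerD2r; apply: energy_nonincreasing => //.
exact: le_trans (stime_ge0 u n) nv.
Qed.

Lemma traj_continuous : {within `[0, +oo[, continuous x}.
Proof.
have [L L0 xL] := traj_lipschitz u x0 B_le0.
apply/subspace_continuousP => t; rewrite /= in_itv /= andbT => t0.
apply: cvg_mx => i j; rewrite ord1; apply/cvgrPdist_le => e e0.
near=> s; have s0 : 0 <= s.
  suff : `[0, +oo[%classic s by rewrite /= in_itv /= andbT.
  by near: s; exact: withinT.
have st : `|t - s| <= e / L.
  near: s; apply: cvg_within; apply: (@cvgr_dist_le _ R^o _ (nbhs t) _ id t cvg_id).
  exact: divr_gt0.
rewrite -[e](@divfK _ L) ?gt_eqF// mulrC; apply: le_trans (ler_wpM2l (ltW L0) st).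
have [ts|/ltW ts] := leP s t.
  by rewrite [in leRHS]ger0_norm ?subr_ge0//; exact: xL.
by rewrite distrC [in leRHS]distrC [in leRHS]ger0_norm ?subr_ge0//; exact: xL.
Unshelve. all: by end_near. Qed.

Lemma traj_in_compact : exists2 K, compact K & forall t, 0 <= t -> K (x t).
Proof.
have [M M0 xM] := traj_bounded u x0 B_le0.
exists [set x : 'cV[R]_d | forall i, `|x i 0| <= M]; first exact: compact_cV_box.
by move=> t t0 i; exact: xM.
Qed.

Lemma connected_traj_limit_set : connected (limit_set x).
Proof.
have [K cK xK] := traj_in_compact.
exact: connected_limit_set cK xK traj_continuous.
Qed.

Lemma compact_traj_limit_set : compact (limit_set x).
Proof.
have [K cK xK] := traj_in_compact.
apply: (subclosed_compact _ cK); first exact: closed_limit_set.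
apply: (@limit_set_sub_closed _ _ _ _ 0) => //.
by apply: compact_closed cK; exact: norm_hausdorff.
Qed.

Lemma traj_limit_set_neq0 : limit_set x !=set0.
Proof.
have [K cK xK] := traj_in_compact.
have [|y xy _] := limit_set_meets cK xK closedT.
  by move=> t0; exists t0.
by exists y.
Qed.

(** On the compact limit set the form of mode i reaches its maximum, which is
    at most 0.  Were it negative, the form would also stay bounded away from 0 along
    the curve at late times, and the unbounded time spent in mode i would
    exhaust the energy. *)
Lemma limit_set_meets_Ker i : i \in J_ u ->
  exists2 y, limit_set x y & y \in Ker B i.
Proof.
move=> iJ; have qc : continuous (quad (Q i)) by exact: continuous_quad.
have [y /set_mem xy ymax] := compact_EVT_max traj_limit_set_neq0 compact_traj_limit_set
  (continuous_subspaceT qc).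
exists y => //; rewrite (mem_Ker_quad _ (B_le0 i)).
have: quad (Q i) y <= 0 by exact: B_le0.
rewrite le_eqVlt => /predU1P[->//|qy_lt0]; exfalso.
pose c := - quad (Q i) y / 2; have c0 : 0 < c by rewrite /c; lra.
have frequent t0 : exists2 t, t0 <= t & - c <= quad (Q i) (x t).
  apply: contrapT => nfreq; pose a := Num.max 0 t0.
  have a0 : 0 <= a by rewrite le_max lexx.
  have dE t k : a <= t -> k \in [set i]%SET -> quad (Q k) (x t) <= - c.
    move=> at_ /set1P ->; rewrite leNgt; apply/negP => /ltW qc_.
    by apply: nfreq; exists t => //; apply: le_trans at_; rewrite le_max lexx orbT.
  have [t t0_ occt] := J_occupation_unbounded iJ
    (occupation u [set i]%SET a + sqn (x a) / c).
  have at_ : a <= t.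
    rewrite leNgt; apply/negP => /ltW /(occupation_nondecreasing u [set i]%SET t0_).
    by move=> le_occ; have := divr_ge0 (sqn_ge0 (x a)) (ltW c0); lra.
  have := @energy_occupation [set i]%SET c a t a0 _ t.
  rewrite at_ lexx => /(_ (fun v k avt => dE v k (proj1 (andP avt))) isT).
  have := sqn_ge0 (x t); move: occt; rewrite -(ltr_pM2l c0) mulrDr.
  rewrite [c * (_ / c)]mulrC divfK ?gt_eqF//.
  by lra.
have [K cK xK] := traj_in_compact.
have [|z xz qz] := limit_set_meets (A := [set z | - c <= quad (Q i) z]) cK xK _ frequent.
  by apply: (@closed_comp _ _ (quad (Q i)) [set z | - c <= z]) => //; exact: closed_ge.
by have := ymax z (mem_set xz); rewrite /c in qz *; move: qz => /=; lra.
Qed.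

(** Subtracting from the energy c times the time spent outside J_u gives a
    nonincreasing function that is bounded below, hence almost constant at late
    times; yet it drops by at least c tau during each visit to a neighbourhood
    where all the modes of J_u dissipate at rate c. *)
Lemma limit_set_sub_Ker y : limit_set x y ->
  exists2 i, i \in J_ u & y \in Ker B i.
Proof.
move=> xy; apply: contrapT => noKer.
have qy i : i \in J_ u -> 0 < - quad (Q i) y.
  move=> iJ; rewrite oppr_gt0 lt_neqAle B_le0 andbT -(mem_Ker_quad _ (B_le0 i)).
  by apply/negP => yi; apply: noKer; exists i.
have [c [c0 cP]] : exists c : R, 0 < c /\ forall i, i \in J_ u -> c < - quad (Q i) y.
  have small : \forall c \near (0 : R)^'+,
      forall i, i \in J_ u -> c < - quad (Q i) y.
    apply: (@filter_forall R 'I_p 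
      (fun i => [set c | i \in J_ u -> c < - quad (Q i) y]) _ _).
    move=> i; have [iJ|iJ] := boolP (i \in J_ u).
      by near=> c => _; near: c; apply: nbhs_right_lt; exact: qy.
    by near=> c.
  apply: (@filter_ex _ (0 : R)^'+); apply: filterS2 small (nbhs_right_gt 0).
  by move=> c cP c0; split.
have : \forall z \near y, forall i, i \in J_ u -> quad (Q i) z < - c.
  apply: (@filter_forall 'cV[R]_d 'I_p
    (fun i => [set z | i \in J_ u -> quad (Q i) z < - c]) (nbhs y) _).
  move=> i; have [iJ|iJ] := boolP (i \in J_ u); last by near=> z.
  near=> z => _; near: z; apply: cvgr_lt; first exact: continuous_quad.
  by rewrite ltrNr; exact: cP.
move=> /nbhs_ballP[e /= e0 eP].
have [L L0 xL] := traj_lipschitz u x0 B_le0.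
(* Starting within e / 2 of y, the curve stays within 3 e / 4 of it for a time
   tau. *)
pose tau := e / (4 * L).
have tau0 : 0 < tau by rewrite divr_gt0// mulr_gt0.
have [M occM] := occupation_notJ_bounded u.
pose G t := sqn (x t) - c * occupation u (~: J_ u) t.
have Gdec s t : 0 <= s -> s <= t -> G t <= G s.
  move=> s0 st; rewrite /G lerB//; first exact: energy_nonincreasing.
  by rewrite ler_pM2l//; exact: occupation_nondecreasing.
have Gm t : 0 <= t -> - (c * M) <= G t.
  by move=> t0; rewrite /G -[leLHS]add0r lerB ?sqn_ge0// ler_pM2l.
have [l [lG Gl]] := nonincreasing_inf_limit Gdec Gm.
have [T T0 GT] := Gl _ (mulr_gt0 c0 tau0).
have e2 : 0 < e / 2 by rewrite divr_gt0.
have [t Tt [_ yxt]] := limit_set_tail T xy (nbhsx_ballx y _ e2).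
have t0 : 0 <= t := le_trans T0 Tt.
have dE s k : t <= s <= t + tau -> k \in J_ u -> quad (Q k) (x s) <= - c.
  case/andP => ts stau kJ; apply/ltW/eP => //; split=> // i j; rewrite ord1.
  have := yxt i 0; rewrite /ball /= => yxti.
  have := xL t s i t0 ts => xts.
  have : L * (s - t) <= e / 4.
    rewrite (_ : e / 4 = L * tau); first by rewrite ler_pM2l//; lra.
    by rewrite /tau; field; rewrite gt_eqF.
  move: yxti xts; rewrite -/(x s) -/(x t).
  rewrite ltr_norml => /andP[? ?]; rewrite ler_norml => /andP[? ?] ?.
  by rewrite ltr_norml; apply/andP; split; lra.
have ttau : t <= t + tau by rewrite lerDl ltW.
have := energy_occupation t0 dE (t := t + tau).
rewrite ttau lexx => /(_ isT).
have := lG (t + tau) (le_trans t0 ttau); have := GT _ Tt; rewrite /G.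
by rewrite !occupationC ?(le_trans t0 ttau)//; lra.
Unshelve. all: by end_near. Qed.

End limit_set_of_trajectory.

(** * Stability *)

Section decay.
Variables (R : realType) (d p : nat) (B : 'I_p -> 'M[R]_d) (u : input R p).
Hypothesis B_le0 : forall i, mx_le0 ((B i)^T + B i).

Lemma component_of_limit_set (x0 : 'cV[R]_d) (r : R) : 0 < r ->
  (forall t, 0 <= t -> r ^+ 2 <= sqn (flow B u t *m x0)) ->
  (forall e, 0 < e -> exists2 T, 0 <= T &
     forall t, T <= t -> sqn (flow B u t *m x0) < r ^+ 2 + e) ->
  ~ no_component_meets_all (Ker B) (J_ u) r.
Proof.
move=> r0 Eger Eler; pose x t := flow B u t *m x0; apply.
have sphere : limit_set x `<=` esphere r.
  move=> y xy; apply/(sqn_esphere _ r0)/eqP; rewrite eq_le; apply/andP; split.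
    apply/ler_addgt0Pr => e /Eler [T T0 TE].
    apply: (@limit_set_sub_closed _ _ x [set y | sqn y <= r ^+ 2 + e] T) xy.
      by apply: (@closed_comp _ _ _ [set v | v <= _]) => [? _|];
        [exact: continuous_sqn|exact: closed_le].
    by move=> t /TE/ltW.
  apply: (@limit_set_sub_closed _ _ x [set y | r ^+ 2 <= sqn y] 0) xy => //.
  by apply: (@closed_comp _ _ _ [set v | _ <= v]) => [? _|];
    [exact: continuous_sqn|exact: closed_ge].
have [y xy] : limit_set x !=set0 by exact: traj_limit_set_neq0.
have sub : limit_set x `<=`
    [set x | exists2 i, i \in J_ u & x \in Ker B i] `&` esphere r.
  by move=> z xz; split; [exact: (limit_set_sub_Ker B_le0 xz)|exact: sphere].
exists (connected_component
  ([set x | exists2 i, i \in J_ u & x \in Ker B i] `&` esphere r) y).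
  by exists y => //; exact: sub.
move=> i iJ; have [z xz zi] := limit_set_meets_Ker B_le0 x0 iJ.
exists z; split => //.
by apply: (connected_component_max xy sub) xz; exact: connected_traj_limit_set.
Qed.

(** Scaling the initial condition multiplies the energy by a constant, so a
    positive limit may be taken equal to r^2 and the contradiction arises on the
    sphere of the given radius. *)
Lemma energy_decay (r : R) (x0 : 'cV[R]_d) : 0 < r ->
  no_component_meets_all (Ker B) (J_ u) r ->
  sqn (flow B u t *m x0) @[t --> +oo] --> (0 : R).
Proof.
move=> r0 noC; pose E t := sqn (flow B u t *m x0).
have [l [lE El]] := nonincreasing_inf_limit (energy_nonincreasing u x0 B_le0)
  (fun t _ => sqn_ge0 (flow B u t *m x0)).
have l_ge0 : 0 <= l.
  apply/ler_addgt0Pr => e /El[T T0 /(_ T (lexx T)) ET].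
  by apply: le_trans (sqn_ge0 (flow B u T *m x0)) (ltW ET).
have [l0|l_neq0] := eqVneq l 0.
  apply/cvgrPdist_lt => e e0; have [T T0 TE] := El _ e0.
  near=> t; rewrite sub0r normrN ger0_norm ?sqn_ge0//.
  rewrite -[e]add0r -{1}l0; apply: TE.
  by near: t; apply: nbhs_pinfty_ge; exact: num_real.
have l_gt0 : 0 < l by rewrite lt_neqAle eq_sym l_neq0.
(* The energy is quadratic, so this factor turns the limit l into r^2. *)
pose a := r / Num.sqrt l.
have aE t : sqn (flow B u t *m (a *: x0)) = r ^+ 2 / l * E t.
  by rewrite -scalemxAr sqnZ expr_div_n sqr_sqrtr.
have k_gt0 : 0 < r ^+ 2 / l by rewrite divr_gt0// exprn_gt0.
exfalso; apply: (@component_of_limit_set (a *: x0) r r0 _ _ noC) => [t t0|e e0].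
  by rewrite aE -[leLHS](@divfK _ l)// ler_pM2l// lE.
have [T T0 TE] := El (e / (r ^+ 2 / l)) (divr_gt0 e0 k_gt0).
exists T => // t /TE; rewrite aE -(ltr_pM2l k_gt0) mulrDr divfK//.
by rewrite [_ * (e / _)]mulrC divfK// gt_eqF.
Unshelve. all: by end_near. Qed.

Lemma stable_of_no_component (r : R) : 0 < r -> no_component_meets_all (Ker B) (J_ u) r ->
  [/\ is_limit_sqrt B u (limit_sqrt B u), limit_sqrt B u = 0
    & asymptotically_stable B u].
Proof.
move=> r0 noC.
have stable : asymptotically_stable B u.
  by move=> x; apply: cvg0_of_sqn; exact: energy_decay noC.
have flow_to0 : flow B u t @[t --> +oo] --> (0 : 'M[R]_d).
  apply: cvg_mx => i j.
  have -> : (0 : 'M[R]_d) i j = (0 : 'cV[R]_d) i 0 by rewrite !mxE.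
  have -> : (fun t => flow B u t i j) =
      (fun t => (flow B u t *m delta_mx j (0 : 'I_1)) i 0).
    by apply/funext => t; rewrite -colE [RHS]mxE.
  exact: cvg_entry (stable _).
have gram0 : (flow B u t)^T *m flow B u t @[t --> +oo] --> (0 : 'M[R]_d).
  have := cvg_mulmx (cvg_trmx flow_to0) flow_to0; rewrite (mulmx0 _ (0 : 'M[R]_d)^T).
  exact.
have lim0 : is_limit_sqrt B u 0.
  split; first by rewrite trmx0.
    by move=> x; rewrite mulmx0 mul0mx mxE.
  by rewrite mulmx0.
have limS : is_limit_sqrt B u (limit_sqrt B u) by exact: (xgetPex 0 (ex_intro _ _ lim0)).
split=> //; have [Ssym _ limSS] := limS.
have SS0 : limit_sqrt B u *m limit_sqrt B u = 0.
  exact: (cvg_unique (@norm_hausdorff _ _) limSS gram0).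
apply/matrixP => i j; rewrite [RHS]mxE.
have /matrixP/(_ j j) := SS0; rewrite -{1}Ssym !mxE.
under eq_bigr do rewrite mxE -expr2.
move/eqP; rewrite psumr_eq0 => [/allP/(_ i)|k _]; last exact: sqr_ge0.
by rewrite mem_index_enum sqrf_eq0 => /(_ isT)/eqP.
Qed.

End decay.

(** * Criteria on the kernels *)

Section components.
Variables (R : realType) (d p : nat) (K : 'I_p -> {vspace 'cV[R]_d}).
Implicit Types J : {set 'I_p}.

(** Every point of the sphere that lies in some subspace belongs to exactly one of
    the two closed unions, over J1 and over the rest of J, so a connected part of
    it that meets the first union stays inside it. *)
Lemma separated_no_component J J1 i j r : 0 < r ->
  i \in J1 -> J1 \subset J -> j \in J :\: J1 ->
  (forall k l, k \in J1 -> l \in J :\: J1 -> (K k :&: K l = 0)%VS) ->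
  no_component_meets_all K J r.
Proof.
move=> r0 iJ1 /fintype.subsetP J1J jJ1 K0.
rewrite /no_component_meets_all; set X := (X in components X).
case=> [_ [x Xx <-] meets].
pose cov (I : {set 'I_p}) := \bigcup_(k in [set k | k \in I]) [set x | x \in K k].
have closed_cov I : closed (cov I).
  by apply: closed_bigcup => [|k _]; [exact: finite_finset|exact: closed_vspace].
have X_disj y : X y -> cov J1 y -> cov (J :\: J1) y -> False.
  move=> [_ yr] [k kJ1 yk] [l lJ1 yl].
  have : y \in (K k :&: K l)%VS by rewrite memv_cap; apply/andP.
  rewrite K0// memv0 => /eqP y0; move: yr; rewrite /esphere /enorm /= y0.
  rewrite big1 ?sqrtr0 => [r00|m _]; last by rewrite mxE expr0n.
  by rewrite -r00 ltxx in r0.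
have X_cov y : X y -> cov J1 y \/ cov (J :\: J1) y.
  case=> [[k kJ yk] _]; have [kJ1|kJ1] := boolP (k \in J1); [left|right].
    by exists k.
  by exists k => //=; rewrite finset.in_setD kJ1.
have Jj : j \in J by move: jJ1; rewrite inE => /andP[].
have [y [Cy yi]] := meets i (J1J i iJ1); have [z [Cz zj]] := meets j Jj.
have CX : connected_component X x `<=` X by exact: connected_component_sub.
have conn := @component_connected _ X x.
suff /seteqP[_ /(_ z Cz)[_]] :
    connected_component X x `&` cov J1 = connected_component X x.
  by move=> zJ1; apply: (X_disj z (CX _ Cz) zJ1); exists j.
apply: conn; first by exists y; split => //; exists i.
- exists (~` cov (J :\: J1)); first exact: closed_openC.
  apply/seteqP; split=> w [Cw Ww]; split=> //; first by move=> /(X_disj w (CX _ Cw) Ww).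
  by have [] := X_cov w (CX _ Cw).
- by exists (cov J1).
Qed.

(** Grow a subfamily one subspace at a time: as long as it is proper, the absence
    of a separation provides a new subspace that meets a previous one nontrivially,
    and adding it to the sum loses at least one dimension. *)
Lemma meeting_component_dim J r : 0 < r -> J != finset.set0 ->
  ~ no_component_meets_all K J r ->
  (\dim (\sum_(i in J) K i) + #|J| <= \sum_(i in J) \dim (K i) + 1)%N.
Proof.
move=> r0 /set0Pn[i0 i0J] meets.
have grow n : (n < #|J|)%N -> exists J1 : {set 'I_p},
    [/\ J1 \subset J, #|J1| = n.+1 &
      (\dim (\sum_(i in J1) K i) + n <= \sum_(i in J1) \dim (K i))%N].
  elim: n => [_|n IH nJ].
    exists [set i0]%SET; rewrite finset.sub1set cards1 !big_set1 addn0; split=> //.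
  have [J1 [J1J J1n dimJ1]] := IH (ltnW nJ).
  have [i iJ1] : exists i, i \in J1 by apply/set0Pn; rewrite -card_gt0 J1n.
  have [j jJ1] : exists j, j \in J :\: J1.
    apply/set0Pn; rewrite -card_gt0 cardsD (finset.setIidPr J1J) J1n subn_gt0.
    exact: nJ.
  have [k [l [kJ1 lJ1 kl0]]] : exists k l, [/\ k \in J1, l \in J :\: J1 &
      (K k :&: K l != 0)%VS].
    apply: contrapT => nokl; apply: meets.
    apply: (separated_no_component r0 iJ1 J1J jJ1) => k l kJ1 lJ1.
    by apply/eqP; apply: contrapT => /negP kl; apply: nokl; exists k, l.
  have [lJ lnJ1] : l \in J /\ l \notin J1 by move: lJ1; rewrite inE => /andP[].
  exists (l |: J1); split.
  - by rewrite finset.subUset finset.sub1set lJ.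
  - by rewrite cardsU1 lnJ1 J1n.
  - rewrite !big_setU1//=; set W := (\sum_(i in J1) K i)%VS in dimJ1 *.
    have capW : (0 < \dim (K l :&: W))%N.
      rewrite lt0n dimv_eq0; apply: contra kl0 => /eqP lW.
      rewrite -subv0 -lW capvC; apply: capvS => //.
      by rewrite /W (bigD1 k)//= addvSl.
    move: (dimv_sum_cap (K l) W) capW dimJ1.
    move: (\dim (K l + W)) (\dim (K l :&: W)) (\dim (K l)) (\dim W) => a b c e.
    by move: (\sum_(_ in J1) _)%N => f; lia.
have J_gt0 : (0 < #|J|)%N by rewrite card_gt0; apply/set0Pn; exists i0.
have [|J1 [J1J J1n dimJ1]] := grow #|J|.-1; first by rewrite prednK.
have J1E : J1 = J by apply/eqP; rewrite eqEcard J1J J1n prednK ?leqnn.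
by rewrite J1E in dimJ1; rewrite addn1 -(prednK J_gt0) addnS ltnS.
Qed.

End components.

Section criteria.
Variables (R : realType) (d p : nat) (K : 'I_p -> {vspace 'cV[R]_d}).
Variables (J : {set 'I_p}) (r : R).
Hypothesis capK0 : (\bigcap_(i in J) K i)%VS = 0%VS.
Hypothesis r_gt0 : 0 < r.

Lemma line_cap_eq0 i k : \dim (K i) = 1%N -> ~~ (K i <= K k)%VS ->
  (K i :&: K k = 0)%VS.
Proof.
move=> Ki1 Kik; apply/eqP; apply: contraNT Kik => cap0.
have capi : (K i :&: K k <= K i)%VS by exact: capvSl.
suff /eqP <- : (K i :&: K k == K i)%VS by exact: capvSr.
rewrite eqEdim capi Ki1 lt0n.
by rewrite dimv_eq0.
Qed.

Lemma card2_no_component : card2_case J -> no_component_meets_all K J r.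
Proof.
move=> /eqP/cards2P[i [j [ij JE]]].
have jDi : j \in J :\: [set i]%SET by rewrite JE !inE eqxx orbT andbT eq_sym.
have sub : [set i]%SET \subset J by rewrite finset.sub1set JE !inE eqxx.
apply: (separated_no_component r_gt0 (set11 i) sub jDi) => k l /set1P ->.
rewrite JE !inE => /andP[li /orP[/eqP lE|/eqP ->]]; first by rewrite lE eqxx in li.
by have := capK0; rewrite JE big_setU1 ?big_set1//= inE.
Qed.

Lemma dim_sum_no_component : dim_sum_case K J -> no_component_meets_all K J r.
Proof.
case=> J_gt2 dimJ; apply: contrapT => meets; move: dimJ; apply/negP.
have J0 : J != finset.set0 by rewrite -card_gt0; apply: leq_trans J_gt2.
have := meeting_component_dim r_gt0 J0 meets.
move: (\dim _) #|J| (\sum_(_ in J) _)%N => a b c abc; rewrite -leNgt; lia.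
Qed.

Lemma trivial_kernel_no_component :
  trivial_kernel_case K J -> no_component_meets_all K J r.
Proof.
case=> i iJ /eqP; rewrite dimv_eq0 => /eqP Ki0.
rewrite /no_component_meets_all; case=> [_ [x _ <-] /(_ i iJ)[y []]].
move=> /connected_component_sub[_ yr] /=; rewrite Ki0 memv0 => /eqP y0.
move: yr; rewrite /esphere /enorm /= y0 big1 ?sqrtr0 => [r0|k _].
  by move: r_gt0; rewrite -r0 ltxx.
by rewrite mxE expr0n.
Qed.

Lemma isolated_line_no_component :
  isolated_line_case K J -> no_component_meets_all K J r.
Proof.
case=> i [iJ Ki1 Ki_iso].
have [j jJ] : exists j, j \in J :\: [set i]%SET.
  apply: contrapT => noj.
  suff : (K i <= \bigcap_(k in J) K k)%VS.
    by rewrite capK0 subv0 -dimv_eq0 Ki1.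
  apply/subv_bigcapP => k kJ; have [->//|ki] := eqVneq k i.
  by exfalso; apply: noj; exists k; rewrite !inE ki.
have sub : [set i]%SET \subset J by rewrite finset.sub1set.
apply: (separated_no_component r_gt0 (set11 i) sub jJ) => k l /set1P ->.
by rewrite !inE => /andP[li lJ]; apply: line_cap_eq0 => //; exact: Ki_iso.
Qed.

(** Barring a zero kernel, all kernels are lines of the plane; two of them differ
    since the intersection is 0, so they span the plane.  With two modes this is the
    first criterion, and with q > 2 modes the second one reads 2 > q - q + 1. *)
Lemma planar_criteria : d = 2%N -> (forall i, i \in J -> K i <> fullv) ->
  [\/ card2_case J, dim_sum_case K J, trivial_kernel_case K J
    | isolated_line_case K J].
Proof.
move=> d2 Kfull; have dimfull : \dim (fullv : {vspace 'cV[R]_d}) = 2%N.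
  by rewrite dimvf dim_matrix d2.
have [[i iJ Ki0]|pos] := pselect (exists2 i, i \in J & \dim (K i) = 0%N).
  by apply: Or43; exists i.
have line i : i \in J -> \dim (K i) = 1%N.
  move=> iJ; apply/eqP; rewrite eqn_leq lt0n; apply/andP; split; last first.
    by apply/eqP => Ki0; apply: pos; exists i.
  rewrite -ltnS -dimfull ltn_neqAle dimvS ?subvf// andbT.
  by apply/eqP => dimE; apply: (Kfull i iJ); apply/eqP; rewrite eqEdim subvf dimE /=.
have [i iJ] : exists i, i \in J.
  apply: contrapT => noJ; have : (fullv <= \bigcap_(i in J) K i)%VS.
    by apply/subv_bigcapP => i iJ; exfalso; apply: noJ; exists i.
  by rewrite capK0 subv0 -dimv_eq0 dimfull.
have [j jJ Kij] : exists2 j, j \in J & ~~ (K i <= K j)%VS.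
  apply: contrapT => noj; suff : (K i <= \bigcap_(k in J) K k)%VS.
    by rewrite capK0 subv0 -dimv_eq0 line.
  by apply/subv_bigcapP => k kJ; apply: contrapT => /negP ?; apply: noj; exists k.
have ij : i != j by apply: contraNneq Kij => ->.
have J2 : (1 < #|J|)%N.
  rewrite (cardsD1 i) iJ ltnS card_gt0; apply/set0Pn; exists j.
  by rewrite !inE eq_sym ij.
have dim_ij : \dim (K i + K j)%VS = 2%N.
  by rewrite dimv_disjoint_sum ?line// line_cap_eq0// line.
have dimJ : (1 < \dim (\sum_(k in J) K k)%VS)%N.
  apply: leq_trans (dimvS (_ : K i + K j <= _)%VS); first by rewrite dim_ij.
  by rewrite subv_add (sumv_sup i) ?(sumv_sup j).
have [J_eq2|J_neq2] := eqVneq #|J| 2%N; first exact: Or41.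
apply: Or42; split; first by rewrite ltn_neqAle eq_sym J_neq2.
rewrite (eq_bigr (fun=> 1%N)) => [|k kJ]; last exact: line.
rewrite sum1_card; move: (\dim _) dimJ => a a1; lia.
Qed.

End criteria.

Theorem theorem6 (R : realType) (d p : nat) (B : 'I_p -> 'M[R]_d)
    (u : input R p) (r : R)
    (B_le0 : forall i, mx_le0 ((B i)^T + B i))
    (capK0 : (\bigcap_(i in J_ u) Ker B i)%VS = 0%VS)
    (r_gt0 : 0 < r) :
  (no_component_meets_all (Ker B) (J_ u) r ->
     [/\ is_limit_sqrt B u (limit_sqrt B u),
         limit_sqrt B u = 0
       & asymptotically_stable B u])
  /\ (card2_case (J_ u) -> no_component_meets_all (Ker B) (J_ u) r)
  /\ (dim_sum_case (Ker B) (J_ u) -> no_component_meets_all (Ker B) (J_ u) r)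
  /\ (trivial_kernel_case (Ker B) (J_ u) -> no_component_meets_all (Ker B) (J_ u) r)
  /\ (isolated_line_case (Ker B) (J_ u) -> no_component_meets_all (Ker B) (J_ u) r)
  /\ (d = 2%N -> (forall i, i \in J_ u -> Ker B i <> fullv) ->
        [\/ card2_case (J_ u), dim_sum_case (Ker B) (J_ u),
            trivial_kernel_case (Ker B) (J_ u) | isolated_line_case (Ker B) (J_ u)]).
Proof.
split; first exact: stable_of_no_component.
split; first exact: card2_no_component.
split; first exact: dim_sum_no_component.
split; first exact: trivial_kernel_no_component.
split; first exact: isolated_line_no_component.
exact: planar_criteria.
Qed.
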